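(* Let $D\subset\mathbb{R}^n$ be a domain containing the origin, let $f:D\to\mathbb{R}^n$ be continuously differentiable with $f(0)=0$, and consider $\dot x=f(x)$. Let $\rho:D\to\mathbb{R}$ be a continuously differentiable function such that $\rho(0)=0$ and $\rho(x_0)>0$ for some $x_0$ with arbitrarily small $\|x_0\|$. Let $B=\{x\in\mathbb{R}^n:\|x\|\le r\}$ with $r>0$ such that $B\subseteq D$, and let $U=\{x\in B:\rho(x)>0\}$; write $\rho^{-1}(x)=1/\rho(x)$ on $U$. The equilibrium $x=0$ is unstable if at least one of the following conditions holds for every $x\in U$: 1) $\mathrm{div}\{\rho(x)f(x)\}>\rho(x)\,\mathrm{div}\{f(x)\}$; 2) $\mathrm{div}\{\rho^{-1}(x)f(x)\}<0$ and $\mathrm{div}\{f(x)\}\ge0$; 3) $\mathrm{div}\{\rho(x)f(x)\}>\beta(x)\rho^2(x)\,\mathrm{div}\{\rho^{-1}(x)f(x)\}$, where either $\beta(x)>1$ and $\mathrm{div}\{f(x)\}\ge0$, or $\beta(x)=1$; 4) $\mathrm{div}\{\rho(x)f(x)\}>0$ and $\mathrm{div}\{\rho^{-1}(x)f(x)\}<0$.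
   Context: $\mathrm{div}\{h(x)\}=\sum_i\partial h_i/\partial x_i$; $\|\cdot\|$ is the Euclidean norm. Instability is in the sense of Lyapunov. *)

(* Defs.v *)
From HB Require Import structures.
From mathcomp Require Import all_boot all_order all_algebra.
From mathcomp Require Import all_classical all_reals all_analysis.
Set Implicit Arguments. Unset Strict Implicit. Unset Printing Implicit Defensive.
Import Order.TTheory GRing.Theory Num.Theory.
Import numFieldNormedType.Exports.
Local Open Scope classical_set_scope.
Local Open Scope ring_scope.

Section Defs.
Context {R : realType} {n : nat}.

Definition enorm (x : 'rV[R]_n) : R := Num.sqrt (\sum_(i < n) x ord0 i ^+ 2).

Definition evec (i : 'I_n) : 'rV[R]_n := delta_mx ord0 i.
Definition partial (i : 'I_n) (g : 'rV[R]_n -> R) (x : 'rV[R]_n) : R :=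
  'D_(evec i) g x.

Definition div (h : 'rV[R]_n -> 'rV[R]_n) (x : 'rV[R]_n) : R :=
  \sum_(i < n) partial i (fun y => h y ord0 i) x.

Definition is_domain (D : set 'rV[R]_n) : Prop := open D /\ connected D.

Definition C1_on {W : normedModType R} (D : set 'rV[R]_n)
    (g : 'rV[R]_n -> W) : Prop :=
  (forall x, D x -> differentiable g x) /\
  (forall i : 'I_n, {within D, continuous ('D_(evec i) g)}).

Definition is_solution (D : set 'rV[R]_n) (f : 'rV[R]_n -> 'rV[R]_n)
    (T : R) (x : R -> 'rV[R]_n) : Prop :=
  forall t, 0 <= t <= T -> D (x t) /\ is_derive t 1 x (f (x t)).

Definition lyap_stable (D : set 'rV[R]_n) (f : 'rV[R]_n -> 'rV[R]_n) : Prop :=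
  forall eps : R, 0 < eps -> exists2 delta : R, 0 < delta &
    forall (T : R) (x : R -> 'rV[R]_n), 0 <= T -> is_solution D f T x ->
      enorm (x 0) < delta -> forall t, 0 <= t <= T -> enorm (x t) < eps.

Definition lyap_unstable D f : Prop := ~ lyap_stable D f.

End Defs.

(* Main.v *)
(* The product rule gives div(rho f) = rho' f + rho div f and
   rho^2 div(rho^-1 f) = - rho' f + rho div f, where rho' f is the derivative of
   rho along f; each of the four conditions then forces rho' f > 0 on U, and the
   theorem becomes Chetaev's: along a trajectory confined to a small ball and
   started where rho > 0, rho would stay above its initial value, hence in a
   compact set where rho' f is bounded below by some gamma > 0, hence grow at
   least linearly, although it is bounded on the ball.
   Since instability requires trajectories to exist, f is composed with the
   coordinatewise clamp onto the sup-norm box [-c, c]^n. The result is bounded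
   and globally Lipschitz, so it has solutions on [0, +oo[, and these solve the
   original equation as long as they stay in the box. *)
Require Import Defs.
From HB Require Import structures.
From mathcomp Require Import all_boot all_order all_algebra.
From mathcomp Require Import all_classical all_reals all_analysis.
Import Order.TTheory GRing.Theory Num.Theory.
Import numFieldNormedType.Exports.
Local Open Scope classical_set_scope.
Local Open Scope ring_scope.
From mathcomp Require Import ring lra.
Set Implicit Arguments. Unset Strict Implicit. Unset Printing Implicit Defensive.

(** * Antiderivatives and coordinatewise differentiation *)

Lemma continuous_antiderivative (R : realType) (h : R -> R) :
  continuous h ->
  exists2 H : R -> R, H 0 = 0 & forall t : R, 0 <= t -> is_derive t 1 H (h t).
Proof.
move=> ch.
(* Integrating from -1 makes every [t >= 0] an interior point, so the derivative at 0 is two-sided;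
   subtracting [F 0] then normalizes the value at 0. *)
pose F (x : R) : R := \int[@lebesgue_measure R]_(t in `[-1, x]) h t.
exists (fun x => F x - F 0) => [|t t0]; first by rewrite subrr.
have [dF eF] : derivable F t 1 /\ (F^`())%classic t = h t.
  apply: (@continuous_FTC1_closed R h (-1) t (t + 1)).
  - by rewrite ltrDl.
  - apply: continuous_compact_integrable; first exact: segment_compact.
    exact: continuous_subspaceT.
  - by rewrite (lt_le_trans _ t0)// ltrN10.
  - exact: ch.
have H1 : is_derive t 1 F (h t).
  by apply: (DeriveDef dF); rewrite -derive1E.
have := is_deriveB H1 (is_derive_cst (F 0) t 1).
by rewrite subr0.
Qed.

Lemma is_derive_rVP (R : realType) n (x : R -> 'rV[R]_n) (t : R) (v : 'rV[R]_n) :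
  is_derive t 1 x v <->
  forall i, is_derive t 1 (fun s => x s ord0 i) (v ord0 i).
Proof.
split=> [[dx <-] i|dx].
  have /derivable_mxP/(_ ord0 i) dxi := dx.
  by apply: DeriveDef => //; rewrite derive_mx// mxE.
have dM : derivable x t 1.
  by apply/derivable_mxP => i j; rewrite ord1; have [] := dx j.
apply: DeriveDef => //; apply/rowP => i.
by rewrite derive_mx// mxE; have [_ ->] := dx i.
Qed.

Lemma continuous_antiderivative_rV (R : realType) n (h : R -> 'rV[R]_n) :
  continuous h ->
  exists2 H : R -> 'rV[R]_n, H 0 = 0 &
    forall t : R, 0 <= t -> is_derive t 1 H (h t).
Proof.
move=> ch.
have /choice[H HP] (i : 'I_n) : exists H : R -> R, H 0 = 0 /\
    forall t : R, 0 <= t -> is_derive t 1 H (h t ord0 i).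
  have [|H H0 dH] := @continuous_antiderivative R (fun t => h t ord0 i).
    move=> t; apply: (@continuous_comp _ _ _ h (fun M : 'rV[R]_n => M ord0 i)).
      exact: ch.
    exact: coord_continuous.
  by exists H.
exists (fun t => \row_i H i t) => [|t t0].
  by apply/rowP => i; rewrite !mxE; have [] := HP i.
apply/is_derive_rVP => i.
rewrite (_ : (fun s => _) = H i); first by have [_ /(_ _ t0)] := HP i.
by apply/funext => s; rewrite mxE.
Qed.

Lemma mx_norm_leP (R : realType) n (x : 'rV[R]_n) (c : R) : 0 <= c ->
  `|x| <= c <-> forall i, `|x ord0 i| <= c.
Proof.
move=> c0; rewrite [`|x|]/Num.Def.normr/= mx_normrE; split=> [xc i|xc].
  apply: le_trans xc.
  exact: (le_bigmax _ (fun ij : 'I_1 * 'I_n => `|x ij.1 ij.2|) (ord0, i)).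
by apply/bigmax_leP; split=> // -[i j] _ /=; rewrite ord1.
Qed.

Lemma coord_le_norm (R : realType) n (x : 'rV[R]_n) i : `|x ord0 i| <= `|x|.
Proof. by have /(_ (lexx _)) := (@mx_norm_leP _ _ x _ (normr_ge0 x)).1. Qed.

(** * Mean value inequalities *)

Lemma derive_ge0_le (R : realType) (f df : R -> R) (a b : R) : a <= b ->
  (forall t : R, a <= t <= b -> is_derive t 1 f (df t)) ->
  (forall t, a <= t <= b -> 0 <= df t) -> f a <= f b.
Proof.
move=> ab dfE df0.
have [| |c cab] := @MVT_segment R f df a b ab.
- move=> t; rewrite in_itv/= => /andP[ta tb]; apply: dfE.
  by rewrite !ltW.
- apply: derivable_within_continuous => t; rewrite in_itv/= => tab.
  by have [] := dfE _ tab.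
rewrite -subr_ge0 => ->; apply: mulr_ge0; last by rewrite subr_ge0.
by apply: df0; move: cab; rewrite in_itv.
Qed.

(** In the sup norm it suffices to treat each coordinate: both [p + y_i] and [p - y_i] have
    nonnegative derivative, so they are nondecreasing. *)
Lemma derive_norm_le (R : realType) n (y dy : R -> 'rV[R]_n)
    (p dp : R -> R) (a b : R) : a <= b ->
  (forall t : R, a <= t <= b -> is_derive t 1 y (dy t)) ->
  (forall t : R, a <= t <= b -> is_derive t 1 p (dp t)) ->
  (forall t, a <= t <= b -> `|dy t| <= dp t) ->
  `|y b - y a| <= p b - p a.
Proof.
move=> ab dyE dpE ydp.
have key (sg : R) i : `|sg| = 1 ->
    p a + sg * y a ord0 i <= p b + sg * y b ord0 i.
  move=> sg1.
  apply: (@derive_ge0_le R (fun t => p t + sg * y t ord0 i)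
           (fun t => dp t + sg * dy t ord0 i)) => // t tab.
    have /is_derive_rVP/(_ i) dyi := dyE _ tab.
    exact: is_deriveD (dpE _ tab) (is_deriveZ sg dyi).
  have : `|sg * dy t ord0 i| <= dp t.
    by rewrite normrM sg1 mul1r (le_trans (coord_le_norm _ _))// ydp.
  by rewrite ler_norml => /andP[? _]; lra.
have pab : 0 <= p b - p a.
  rewrite subr_ge0; apply: (@derive_ge0_le R p dp) => // t tab.
  by rewrite (le_trans _ (ydp _ tab)).
apply/mx_norm_leP => // i; rewrite !mxE.
have := key 1 i (normr1 _); have := key (-1) i; rewrite normrN1 => /(_ erefl).
rewrite !mul1r !mulN1r => h1 h2.
rewrite ler_norml; apply/andP; split; lra.
Qed.

(** * Geometric convergence, Lipschitz maps and Picard iteration *)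

Lemma le_add_geometric (R : realType) (a b c : R) :
  (forall k, a <= b + c / 2 ^+ k) -> a <= b.
Proof.
move=> abc; have : (fun k => b + geometric c 2^-1 k) @ \oo --> b + 0.
  apply: cvgD; first exact: cvg_cst.
  by apply: cvg_geometric; rewrite ger0_norm ?invr_ge0// invf_lt1 ?ltr1n.
rewrite addr0 => cb; rewrite -(cvg_lim (@Rhausdorff R) cb).
apply: limr_ge; first exact: cvgP cb.
by near=> k; rewrite /= exprVn; exact: abc.
Unshelve. all: by end_near. Qed.

Lemma cvg_geometric_step (R : realType) n (u : nat -> 'rV[R]_n) (c : R) :
  (forall k, `|u k.+1 - u k| <= c / 2 ^+ k) ->
  exists l, forall k, `|l - u k| <= c * 2 / 2 ^+ k.
Proof.
move=> uc.
have c0 : 0 <= c by have := uc 0%N; rewrite expr0 divr1; apply: le_trans.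
(* The factor [1 - 2^-1 ^+ m] keeps the exact partial geometric sum, without which the induction on
   [m] would not close. *)
have tail k m : `|u (k + m)%N - u k| <= c * 2 / 2 ^+ k * (1 - 2^-1 ^+ m).
  elim: m => [|m IH]; first by rewrite addn0 subrr normr0 expr0 subrr mulr0.
  rewrite addnS -(subrKA (u (k + m)%N)) (le_trans (ler_normD _ _))//.
  apply: (le_trans (lerD (uc _) IH)).
  rewrite exprD invfM exprS -!exprVn.
  set p := 2^-1 ^+ k; set q := 2^-1 ^+ m.
  by rewrite le_eqVlt; apply/orP; left; apply/eqP; field.
have tail' k m : `|u (k + m)%N - u k| <= c * 2 / 2 ^+ k.
  apply: le_trans (tail k m) _; apply: ler_piMr.
    by rewrite divr_ge0 ?mulr_ge0 ?exprn_ge0.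
  by rewrite lerBlDr lerDl exprn_ge0 ?invr_ge0.
have : cvgn u.
  apply/cauchy_cvgP/cauchy_exP => e e0.
  have /cvgr0Pnorm_lt/(_ e e0) : geometric (c * 2) (2^-1 : R) @ \oo --> 0.
    by apply: cvg_geometric; rewrite ger0_norm ?invr_ge0// invf_lt1 ?ltr1n.
  case=> N _ /(_ N (leqnn N)) /= HN.
  exists (u N); exists N => // i /= Ni.
  rewrite -ball_normE /= distrC -(subnKC Ni) (le_lt_trans (tail' _ _))//.
  by rewrite (le_lt_trans _ HN)// exprVn ler_norm.
move=> cu; exists (lim (u @ \oo)) => k.
have : (fun m => `|u (m + k)%N - u k|) @ \oo --> `|lim (u @ \oo) - u k|.
  apply: cvg_norm; apply: cvgB; last exact: cvg_cst.
  by rewrite cvg_shiftn.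
move=> cl; rewrite -(cvg_lim (@Rhausdorff R) cl).
apply: limr_le; first exact: cvgP cl.
by near=> m; rewrite addnC.
Unshelve. all: by end_near. Qed.

Lemma lipschitz_bound_continuous (R : realType) (V W : normedModType R)
    (f : V -> W) (k : R) :
  (forall x y, `|f x - f y| <= k * `|x - y|) -> continuous f.
Proof.
move=> fk x; apply/cvgrPdist_lt => e e0.
have k1 : 0 < `|k| + 1 by rewrite ltr_wpDl.
near=> y; apply: (le_lt_trans (fk _ _)).
apply: (@le_lt_trans _ _ ((`|k| + 1) * `|x - y|)).
  by rewrite ler_wpM2r// (le_trans (ler_norm _))// lerDl.
rewrite mulrC -ltr_pdivlMr//.
near: y; apply: cvgr_dist_lt; first exact: cvg_id.
by rewrite divr_gt0.
Unshelve. all: by end_near. Qed.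

Lemma dist_maxr (R : realType) (k s t : R) :
  `|Num.max s k - Num.max t k| <= `|s - t|.
Proof.
have h1 := ler_norm (s - t); have h2 := ler_norm (t - s).
rewrite distrC in h2; rewrite ler_norml.
by case: (lerP s k) => ?; case: (lerP t k) => ?; apply/andP; split; lra.
Qed.

Lemma dist_minr (R : realType) (k s t : R) :
  `|Num.min s k - Num.min t k| <= `|s - t|.
Proof.
have h1 := ler_norm (s - t); have h2 := ler_norm (t - s).
rewrite distrC in h2; rewrite ler_norml.
by case: (lerP s k) => ?; case: (lerP t k) => ?; apply/andP; split; lra.
Qed.

(* The iterates are frozen for negative times so that the limit satisfies the
   equation with a two-sided derivative at 0; the factor exp(2Lt) turns the
   Picard step into a contraction of ratio 1/2 on the whole half line. *)
Lemma picard_lindelof (R : realType) n (g : 'rV[R]_n -> 'rV[R]_n) (L B : R) :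
  0 < L -> (forall x y, `|g x - g y| <= L * `|x - y|) ->
  (forall x, `|g x| <= B) ->
  forall x0, exists2 x : R -> 'rV[R]_n, x 0 = x0 &
    forall t : R, 0 <= t -> is_derive t 1 x (g (x t)).
Proof.
move=> L0 gL gB x0.
have B0 : 0 <= B by rewrite (le_trans _ (gB x0)).
(* The operator [J] has to be total in order to be iterated; a discontinuous [h] receives a dummy
   value. *)
have /choice[J JP] (h : R -> 'rV[R]_n) : exists H : R -> 'rV[R]_n,
    continuous h ->
    H 0 = 0 /\ forall t : R, 0 <= t -> is_derive t 1 H (h t).
  have [ch|nch] := pselect (continuous h); last by exists (fun=> 0).
  by have [H H0 dH] := continuous_antiderivative_rV ch; exists H.
(* This is the invariant of the iteration: it makes [G y] continuous, hence integrable, and [T]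
   preserves it because [g] is bounded by [B]. *)
pose lip (y : R -> 'rV[R]_n) :=
  forall s t, 0 <= s -> 0 <= t -> `|y s - y t| <= B * `|s - t|.
pose G (y : R -> 'rV[R]_n) (s : R) := g (y (Num.max s 0)).
pose T y t := x0 + J (G y) t.
have cG y : lip y -> continuous (G y).
  move=> ly; apply: (@lipschitz_bound_continuous _ _ _ _ (L * B)) => s t.
  rewrite (le_trans (gL _ _))// -mulrA ler_wpM2l ?(ltW L0)//.
  rewrite (le_trans (ly _ _ _ _)) ?le_max ?lexx ?orbT//.
  by rewrite ler_wpM2l// dist_maxr.
have T0 y : lip y -> T y 0 = x0.
  by move=> /cG/JP[J0 _]; rewrite /T J0 addr0.
have dT y (t : R) : lip y -> 0 <= t -> is_derive t 1 (T y) (g (y t)).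
  move=> /cG/JP[_ dJ] t0; have := dJ _ t0.
  rewrite /G max_l// => dJt.
  by have := is_deriveD (is_derive_cst x0 t 1) dJt; rewrite add0r.
have lT y : lip y -> lip (T y).
  move=> ly.
  have key s t : 0 <= s -> s <= t -> `|T y t - T y s| <= B * t - B * s.
    move=> s0 st.
    apply: (@derive_norm_le _ _ (T y) (fun r => g (y r))
              (fun r => B * r) (fun=> B)) => // r /andP[sr rt].
      by apply: dT => //; exact: le_trans sr.
    have := is_deriveZ B (is_derive_id r 1).
    by rewrite /GRing.scale/= mulr1.
  move=> s t s0 t0; case: (leP s t) => [st|/ltW ts].
    by rewrite distrC (le_trans (key s t s0 st))// distrC -mulrBr
      ger0_norm ?subr_ge0.
  by rewrite (le_trans (key t s t0 ts))// -mulrBr ger0_norm ?subr_ge0.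
pose E (t : R) := expR (2 * L * t).
have dE (c t : R) : is_derive t 1 (fun r => c * E r) (c * (2 * L * E t)).
  have d1 : is_derive t 1 (fun r : R => 2 * L * r) (2 * L).
    have := is_deriveZ (2 * L) (is_derive_id t 1).
    by rewrite /GRing.scale/= mulr1.
  have d2 : is_derive t 1 E (2 * L * E t).
    have := is_derive1_comp (is_derive_expR (2 * L * t)) d1.
    by rewrite /E [X in is_derive _ _ _ X -> _]mulrC.
  have d3 : is_derive t 1 (c *: E) (c * (2 * L * E t)) := is_deriveZ c d2.
  exact: d3.
have E0 (t : R) : 0 <= E t by exact: expR_ge0.
(* The derivative of [T y - T z] is bounded by [L * (c * E)], which is exactly the derivative of
   [c / 2 * E]. *)
have step y z (c : R) : lip y -> lip z -> 0 <= c ->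
    (forall t, 0 <= t -> `|y t - z t| <= c * E t) ->
    forall t, 0 <= t -> `|T y t - T z t| <= c / 2 * E t.
  move=> ly lz c0 yz t t0.
  have := @derive_norm_le _ _ (fun r => T y r - T z r)
    (fun r => g (y r) - g (z r)) (fun r => c / 2 * E r)
    (fun r => c / 2 * (2 * L * E r)) 0 t t0.
  rewrite !T0// subrr subr0 => H; apply: (le_trans (H _ (fun r _ => dE _ r) _)).
  - move=> r /andP[r0 _]; apply: is_deriveB; exact: dT.
  - move=> r /andP[r0 _]; rewrite (le_trans (gL _ _))//.
    have -> : c / 2 * (2 * L * E r) = L * (c * E r) by field.
    by rewrite ler_wpM2l ?(ltW L0)// yz.
  - by rewrite lerBlDr lerDl mulr_ge0// divr_ge0.
pose u := fun k => iter k T (fun=> x0).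
have lu k : lip (u k).
  elim: k => [s t _ _|k IH]; last exact: lT.
  by rewrite subrr normr0 mulr_ge0.
(* Chosen so that the first increment, at most [B * t], is at most [c * E t], by
   [1 + 2 * L * t <= E t]. *)
pose c : R := B / (2 * L).
have c0 : 0 <= c by rewrite divr_ge0// mulr_ge0// ltW.
have uS k t : 0 <= t -> `|u k.+1 t - u k t| <= c / 2 ^+ k * E t.
  elim: k t => [t t0|k IH t t0].
    rewrite expr0 divr1.
    have := lu 1%N t 0 t0 (lexx _); rewrite /u/= T0; last exact: (lu 0%N).
    move=> /le_trans; apply; rewrite subr0 ger0_norm// /c /E.
    have := expR_ge1Dx (2 * L * t); set e := expR _ => He.
    rewrite -mulrA ler_wpM2l// -ler_pdivrMl ?invr_gt0 ?mulr_gt0//.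
    by rewrite invrK; lra.
  rewrite exprS invfM mulrCA [_ * (c / _)]mulrC.
  apply: (step _ _ _ (lu k.+1) (lu k) _ IH) => //.
  by rewrite divr_ge0// exprn_ge0.
clearbody c.
have /choice[y yu] t : exists l, 0 <= t ->
    forall k, `|l - u k t| <= c * E t * 2 / 2 ^+ k.
  case: (leP 0 t) => t0; last by exists 0.
  have [k|l lu'] := @cvg_geometric_step R n (u ^~ t) (c * E t).
    by rewrite mulrAC uS.
  by exists l.
have ly : lip y.
  move=> s t s0 t0.
  apply: (@le_add_geometric _ _ _ (c * E s * 2 + c * E t * 2)) => k.
  rewrite -(subrKA (u k s)) (le_trans (ler_normD _ _))// mulrDl.
  rewrite -[u k s - y t](subrKA (u k t)) [leRHS]addrCA lerD//.
    exact: yu.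
  rewrite (le_trans (ler_normD _ _))// lerD//; first exact: lu.
  by rewrite distrC yu.
(* The limit [y] is arbitrary at negative times and may fail to be differentiable at 0, whereas
   [T y] agrees with it for [t >= 0] and has two-sided derivatives there. *)
exists (T y); first exact: T0.
move=> t t0; suff -> : T y t = y t by exact: dT.
apply/eqP; rewrite -subr_eq0 -normr_le0.
(* Both [T y t] and [y t] lie within [c * E t / 2 ^+ k] of [u k.+1 t], the former by contraction
   since [u k.+1 = T (u k)]. *)
apply: (@le_add_geometric _ _ _ (c * E t * 2)) => k.
rewrite add0r -(subrKA (u k.+1 t)); apply: (le_trans (ler_normD _ _)).
have ck0 : 0 <= c * 2 / 2 ^+ k.
  by apply: divr_ge0; [exact: mulr_ge0|exact: exprn_ge0].
have yk r : 0 <= r -> `|y r - u k r| <= c * 2 / 2 ^+ k * E r.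
  by move=> r0; rewrite (le_trans (yu r r0 k))// le_eqVlt; apply/orP; left;
    apply/eqP; ring.
have h1 := step y (u k) _ ly (lu k) ck0 yk t t0.
have h2 := yu t t0 k.+1; rewrite distrC in h2.
apply: (le_trans (lerD h1 h2)).
rewrite exprS invfM le_eqVlt; apply/orP; left; apply/eqP; field.
by rewrite expf_neq0.
Qed.

(** * Chain rule along curves and Lipschitz bounds on compact boxes *)

Lemma derive_sum_evec (R : realType) n (W : normedModType R)
    (g : 'rV[R]_n -> W) (z v : 'rV[R]_n) :
  differentiable g z -> 'D_v g z = \sum_i v ord0 i *: 'D_(evec i) g z.
Proof.
move=> dg; rewrite deriveE// [in LHS](row_sum_delta v) linear_sum.
by apply: eq_bigr => i _; rewrite linearZ deriveE.
Qed.

Lemma is_derive_comp_rV (R : realType) n (W : normedModType R) (g : 'rV[R]_n -> W)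
    (x : R -> 'rV[R]_n) (t : R) (v : 'rV[R]_n) :
  differentiable g (x t) -> is_derive t 1 x v ->
  is_derive t 1 (fun s => g (x s)) ('D_v g (x t)).
Proof.
move=> dg [/derivable1_diffP dx dxE].
have dgx : differentiable (g \o x) t by exact: differentiable_comp.
apply: DeriveDef; first exact: diff_derivable.
by rewrite (deriveE _ dgx) diff_comp// [RHS]deriveE// -dxE [in RHS]deriveE.
Qed.

Lemma box_compact (R : realType) n (c : R) :
  compact [set x : 'rV[R]_n | `|x| <= c].
Proof.
apply: bounded_closed_compact.
  exists c; split; first exact: num_real.
  by move=> d cd x /= /le_trans; apply; exact: ltW.
have -> : [set x : 'rV[R]_n | `|x| <= c] = Num.norm @^-1` [set y | y <= c] by [].
by apply: preimage_closed; [move=> x _; exact: norm_continuous|exact: closed_le].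
Qed.

(** Compactness bounds each partial derivative by some [K i]; convexity keeps the segment from [y]
    to [x] in the box, where the mean value inequality applies. The summand 1 in the constant only
    ensures positivity. *)
Lemma C1_lipschitz_box (R : realType) n (D : set 'rV[R]_n)
    (f : 'rV[R]_n -> 'rV[R]_n) (c : R) :
  0 <= c -> C1_on D f -> [set x | `|x| <= c] `<=` D ->
  exists2 L : R, 0 < L & forall x y, `|x| <= c -> `|y| <= c ->
    `|f x - f y| <= L * `|x - y|.
Proof.
move=> c0 [df cf] BD.
have box0 : [set x : 'rV[R]_n | `|x| <= c] !=set0.
  by exists 0; rewrite /= normr0.
have /choice[K KP] (i : 'I_n) : exists K : R,
    forall z, `|z| <= c -> `|'D_(evec i) f z| <= K.
  have [|z _ zP] := compact_EVT_max box0 (@box_compact R n c)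
      (f := fun z => `|'D_(evec i) f z|).
    move=> z; apply: continuous_comp; last exact: norm_continuous.
    exact: (continuous_subspaceW BD (cf i)).
  by exists `|'D_(evec i) f z| => y yc; apply: zP; rewrite inE.
have K0 i : 0 <= K i by rewrite (le_trans _ (KP i 0 _))// normr0.
exists (1 + \sum_i K i); first by rewrite ltr_wpDr// sumr_ge0.
move=> x y xc yc; set L := 1 + _.
pose z (s : R) : 'rV[R]_n := y + s *: (x - y).
have zc s : 0 <= s <= 1 -> `|z s| <= c.
  move=> /andP[s0 s1].
  have -> : z s = (1 - s) *: y + s *: x.
    by rewrite /z scalerBr scalerBl scale1r addrA addrAC.
  rewrite (le_trans (ler_normD _ _))// !normrZ !ger0_norm ?subr_ge0//.
  have -> : c = (1 - s) * c + s * c by ring.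
  by rewrite lerD// ler_wpM2l ?subr_ge0.
have dz (s : R) : is_derive s 1 z (x - y).
  have : is_derive s 1 ( *:%R^~ (x - y) : R -> 'rV[R]_n) (x - y).
    apply: DeriveDef; first exact/derivable1_diffP.
    by rewrite deriveE// diff_val scale1r.
  move=> /(is_deriveD (is_derive_cst y s 1)).
  by rewrite add0r.
have := @derive_norm_le R n (fun s => f (z s)) (fun s => 'D_(x - y) f (z s))
  (fun s => s * (L * `|x - y|)) (fun=> L * `|x - y|) 0 1 ler01.
have -> : z 1 = x by rewrite /z scale1r addrC subrK.
have -> : z 0 = y by rewrite /z scale0r addr0.
rewrite mul1r mul0r subr0; apply.
- move=> s s01.
  have dfz : differentiable f (z s) by apply: df; apply: BD; exact: zc.
  exact: is_derive_comp_rV dfz (dz s).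
- move=> s _.
  have -> : (fun u => u * (L * `|x - y|)) = (L * `|x - y|) *: (@id R).
    by apply/funext => u; rewrite mulrC.
  by have := is_deriveZ (L * `|x - y|) (is_derive_id s 1);
    rewrite [_ *: 1]mulr1.
move=> s s01; rewrite derive_sum_evec; last by apply: df; apply: BD; exact: zc.
rewrite (le_trans (ler_norm_sum _ _ _))//.
apply: (@le_trans _ _ (\sum_i K i * `|x - y|)).
  apply: ler_sum => i _; rewrite normrZ mulrC.
  by apply: ler_pM => //; [apply: KP; exact: zc|exact: coord_le_norm].
by rewrite -mulr_suml ler_wpM2r// /L lerDr.
Qed.

(** * The retraction onto a sup-norm box *)

Definition clamp (R : realType) n (c : R) (x : 'rV[R]_n) : 'rV[R]_n :=
  \row_i Num.max (Num.min (x ord0 i) c) (- c).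

Lemma clamp_norm_le (R : realType) n (c : R) (x : 'rV[R]_n) :
  0 <= c -> `|clamp c x| <= c.
Proof.
move=> c0; apply/mx_norm_leP => // i; rewrite mxE ler_norml le_max lexx/=.
by rewrite orbT ge_max ge_min lexx orbT/= lerNl (le_trans _ c0)// oppr_le0.
Qed.

Lemma clamp_id (R : realType) n (c : R) (x : 'rV[R]_n) :
  `|x| <= c -> clamp c x = x.
Proof.
move=> xc; apply/rowP => i; rewrite mxE.
have := le_trans (coord_le_norm x i) xc; rewrite ler_norml => /andP[h1 h2].
by rewrite min_l// max_l.
Qed.

(** Since [min] and [max] with a constant are 1-Lipschitz, composing with [clamp c] preserves
    sup-norm Lipschitz constants. *)
Lemma clamp_dist (R : realType) n (c : R) (x y : 'rV[R]_n) :
  `|clamp c x - clamp c y| <= `|x - y|.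
Proof.
apply/mx_norm_leP => // i; rewrite !mxE.
have := coord_le_norm (x - y) i; rewrite !mxE; apply: le_trans.
exact: le_trans (dist_maxr _ _ _) (dist_minr _ _ _).
Qed.

(** * First hitting times and persistence of positivity *)

(** The time is the infimum of those with [c <= h t]. Continuity puts the infimum itself in this
    set, and the intermediate value theorem yields equality at a time that cannot precede it. *)
Lemma first_hitting (R : realType) (h : R -> R) (c b : R) :
  (forall t, 0 <= t -> {for t, continuous h}) -> h 0 < c ->
  0 <= b -> c <= h b ->
  exists s, [/\ 0 <= s, h s = c & forall t, 0 <= t < s -> h t < c].
Proof.
move=> ch h0c b0 hbc.
pose S := [set t : R | 0 <= t /\ c <= h t].
have hiS : has_inf S by split; [exists b|exists 0 => t []].
have S0 : 0 <= inf S by apply: lb_le_inf => [|t []//]; exists b.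
have below t : 0 <= t < inf S -> h t < c.
  move=> /andP[t0 tS]; rewrite ltNge; apply/negP => ct.
  by move: tS; rewrite ltNge ge_inf//; case: hiS.
have hS : c <= h (inf S).
  rewrite leNgt; apply/negP => hSc.
  have : \forall t \near inf S, h t < c.
    exact: (cvgr_lt (h (inf S)) (ch _ S0)).
  move=> /nbhs_ballP[e /= e0 eP].
  have [t [t0 ct] tS] := inf_adherent e0 hiS.
  have St : inf S <= t by apply: ge_inf => //; case: hiS.
  have : h t < c.
    by apply: eP; rewrite /ball/= distrC ger0_norm ?subr_ge0// ltrBlDl.
  by rewrite ltNge ct.
exists (inf S); split => //.
have [| |s] := @IVT R h 0 (inf S) c S0.
- apply: continuous_in_subspaceT => t; rewrite inE/= in_itv/= => /andP[t0 _].
  exact: ch.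
- by rewrite ge_min ltW//= le_max hS orbT.
rewrite in_itv/= => /andP[s0 sS] hsc.
suff <- : s = inf S by [].
apply/eqP; rewrite eq_le sS/= leNgt; apply/negP => sltS.
by have := below s; rewrite s0 sltS hsc ltxx => /(_ isT).
Qed.

Lemma is_derive_continuous (R : realType) (V : normedModType R)
    (x : R -> V) (t : R) v :
  is_derive t 1 x v -> {for t, continuous x}.
Proof.
by move=> [/derivable1_diffP dx _]; exact: differentiable_continuous.
Qed.

(** The sign of the derivative is known only while [V > 0], but this sustains itself: up to the
    first time [V] falls to [V 0 / 2] it is positive, hence nondecreasing, a contradiction. *)
Lemma derive_ge0_positive (R : realType) (V dV : R -> R) :
  (forall t : R, 0 <= t -> is_derive t 1 V (dV t)) -> 0 < V 0 ->
  (forall t, 0 <= t -> 0 < V t -> 0 <= dV t) ->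
  forall t, 0 <= t -> V 0 <= V t.
Proof.
move=> VE V0 dV0.
have mono t : 0 <= t -> (forall s, 0 <= s <= t -> 0 < V s) -> V 0 <= V t.
  move=> t0 Vpos; apply: (derive_ge0_le t0 (df := dV)) => s s0t.
    by apply: VE; case/andP: s0t.
  by apply: dV0; [case/andP: s0t|exact: Vpos].
suff Vh t : 0 <= t -> V 0 / 2 < V t.
  move=> t t0; apply: mono => // s /andP[s0 _].
  by rewrite (lt_trans _ (Vh s s0))// divr_gt0.
move=> t0; rewrite ltNge; apply/negP => Vt.
have [| | |s [s0 Vs sP]] :=
  @first_hitting R (fun u => - V u) (- (V 0 / 2)) t _ _ t0.
- by move=> u u0; apply: continuousN; exact: (is_derive_continuous (VE _ u0)).
- by lra.
- by lra.
have : V 0 <= V s.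
  apply: mono => // u /andP[u0]; rewrite le_eqVlt => /predU1P[->|us].
    by lra.
  by have := sP u; rewrite u0 us => /(_ isT); lra.
by lra.
Qed.

(** * Euclidean versus sup norm, and product rules for the divergence *)

Lemma norm_le_enorm (R : realType) n (x : 'rV[R]_n) : `|x| <= enorm x.
Proof.
apply/mx_norm_leP => [|i]; first exact: sqrtr_ge0.
rewrite -sqrtr_sqr ler_wsqrtr// (bigD1 i)//= lerDl sumr_ge0// => j _.
exact: sqr_ge0.
Qed.

(** The crude factor [n.+1] in place of the square root of [n] is nonzero even for [n = 0], and
    [n <= n.+1 ^ 2] is enough. *)
Lemma enorm_le (R : realType) n (x : 'rV[R]_n) (r : R) :
  `|x| <= r / n.+1%:R -> enorm x <= r.
Proof.
move=> xr.
have rn0 : 0 <= r / n.+1%:R by rewrite (le_trans _ xr).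
have r0 : 0 <= r by move: rn0; rewrite pmulr_lge0// invr_gt0 ltr0n.
rewrite -(ger0_norm r0) -sqrtr_sqr ler_wsqrtr//.
apply: (@le_trans _ _ (\sum_(i < n) (r / n.+1%:R) ^+ 2)).
  apply: ler_sum => i _; rewrite -[leLHS]real_normK ?num_real//.
  by rewrite ler_sqr ?nnegrE// (le_trans (coord_le_norm _ _)).
rewrite sumr_const card_ord -[r in leRHS](@divfK _ n.+1%:R) ?pnatr_eq0//.
rewrite [leRHS]exprMn -[leLHS]mulr_natr ler_wpM2l ?sqr_ge0//.
by rewrite -natrX ler_nat (leq_trans (leqnSn n))// -mulnn leq_pmulr.
Qed.

Lemma div_scale (R : realType) n (g : 'rV[R]_n -> R)
    (f : 'rV[R]_n -> 'rV[R]_n) (x : 'rV[R]_n) :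
  differentiable g x -> differentiable f x ->
  div (fun y => g y *: f y) x = 'D_(f x) g x + g x * div f x.
Proof.
move=> dg df; rewrite /div derive_sum_evec// mulr_sumr -big_split/=.
apply: eq_bigr => i _; rewrite /partial.
have dfi : derivable (fun y => f y ord0 i) x (evec i).
  apply: diff_derivable.
  apply: (@differentiable_comp _ _ _ _ f (fun N : 'rV[R]_n => N ord0 i)) => //.
  exact: differentiable_coord.
have -> : (fun y => (g y *: f y) ord0 i) = g * (fun y => f y ord0 i).
  by apply/funext => y; rewrite mxE.
by rewrite deriveM//; [rewrite addrC|exact: diff_derivable].
Qed.

Lemma div_scaleV (R : realType) n (g : 'rV[R]_n -> R)
    (f : 'rV[R]_n -> 'rV[R]_n) (x : 'rV[R]_n) :
  differentiable g x -> differentiable f x -> g x != 0 ->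
  div (fun y => (g y)^-1 *: f y) x =
  - (g x) ^- 2 * 'D_(f x) g x + (g x)^-1 * div f x.
Proof.
move=> dg df gx0; rewrite div_scale//; last exact: differentiableV.
by rewrite deriveV//; exact: diff_derivable.
Qed.

Lemma continuous_sum_at (R : realType) (T : topologicalType)
    (V : normedModType R) n (F : 'I_n -> T -> V) (z : T) :
  (forall i, {for z, continuous (F i)}) ->
  {for z, continuous (fun y => \sum_i F i y)}.
Proof.
by move=> cF; apply: cvg_big => [|i _]; [exact: add_continuous|exact: cF].
Qed.

(** * Chetaev's instability theorem on a sup-norm box *)

Theorem chetaev_instability (R : realType) n (D : set 'rV[R]_n)
    (f : 'rV[R]_n -> 'rV[R]_n) (rho : 'rV[R]_n -> R) (c : R) :
  open D -> C1_on D f -> f 0 = 0 -> C1_on D rho -> 0 < c ->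
  [set x | `|x| <= c] `<=` D ->
  (forall e : R, 0 < e -> exists2 x0, enorm x0 < e & 0 < rho x0) ->
  (forall x, `|x| <= c -> 0 < rho x -> 0 < 'D_(f x) rho x) ->
  lyap_unstable D f.
Proof.
move=> oD Cf f0 [drho crho] c0 BD rhopos Drho stable.
(* Stability with [eps = c] confines trajectories to the open box, the sup norm being at most the
   Euclidean one. *)
have [delta delta0 stab] := stable c c0.
have [|x0] := rhopos (Num.min delta c); first by rewrite lt_min delta0 c0.
rewrite lt_min => /andP[x0delta x0c] rhox0.
have [L L0 fL] := C1_lipschitz_box (ltW c0) Cf BD.
have cc (x : 'rV[R]_n) : `|clamp c x| <= c by exact: clamp_norm_le (ltW c0).
(* The bound [L * c] on the clamped field comes from [f 0 = 0] and the Lipschitz estimate. *)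
have [||x xx0 dx] := @picard_lindelof R n (f \o clamp c) L (L * c) L0 _ _ x0.
- move=> x y; rewrite (le_trans (fL _ _ _ _))// ler_wpM2l ?(ltW L0)//.
  exact: clamp_dist.
- move=> x; have := fL (clamp c x) 0 (cc x).
  rewrite normr0 f0 !subr0 => /(_ (ltW c0))/le_trans; apply.
  by rewrite ler_wpM2l ?(ltW L0).
(* Up to a first time [s] with [|x s| = c] the clamp acts trivially, so [x] solves the original
   equation on [[0, s]], and stability gives [enorm (x s) < c], a contradiction. *)
have xc t : 0 <= t -> `|x t| < c.
  move=> t0; rewrite ltNge; apply/negP => ct.
  have [| |s [s0 xs sP]] := @first_hitting R (fun t => `|x t|) c t _ _ t0 ct.
  - move=> u u0; apply: (@continuous_comp _ _ _ x); last exact: norm_continuous.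
    exact: is_derive_continuous (dx u u0).
  - by rewrite xx0 (le_lt_trans (norm_le_enorm _)).
  suff : enorm (x s) < c by rewrite ltNge (le_trans _ (norm_le_enorm _))// xs.
  apply: (stab s x s0) => [u /andP[u0]||]; last by rewrite s0 lexx.
    rewrite le_eqVlt => us.
    have xu : `|x u| <= c.
      by case/predU1P: us => [->|us]; [rewrite xs|rewrite ltW// sP// u0].
    by split; [exact: BD|have := dx u u0; rewrite /= clamp_id].
  by rewrite xx0.
have xcW t : 0 <= t -> `|x t| <= c by move=> /xc/ltW.
have {}dx (t : R) : 0 <= t -> is_derive t 1 x (f (x t)).
  by move=> t0; have := dx t t0; rewrite /= clamp_id// xcW.
pose V t := rho (x t); pose W z := 'D_(f z) rho z.
have dV (t : R) : 0 <= t -> is_derive t 1 V (W (x t)).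
  move=> t0.
  have dr : differentiable rho (x t) by apply: drho; apply: BD; exact: xcW.
  exact: is_derive_comp_rV dr (dx t t0).
have V0 : V 0 = rho x0 by rewrite /V xx0.
have VV0 t : 0 <= t -> V 0 <= V t.
  apply: derive_ge0_positive dV _ _ t; first by rewrite V0.
  by move=> t t0 Vt; rewrite ltW// Drho// xcW.
pose box := [set z : 'rV[R]_n | `|z| <= c].
have cbox : compact box by exact: box_compact.
have crhob : {within box, continuous rho}.
  apply: continuous_in_subspaceT => z; rewrite inE => zc.
  by apply: differentiable_continuous; exact/drho/BD.
have box0 : box !=set0 by exists (x 0); exact: xcW.
have [zM _ zMP] := compact_EVT_max box0 cbox crhob.
have rhoM t : 0 <= t -> V t <= rho zM by move=> t0; rewrite zMP// inE; exact: xcW.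
pose K := box `&` [set z | rho x0 <= rho z].
have cclamp : continuous (@clamp R n c).
  apply: (@lipschitz_bound_continuous _ _ _ _ 1) => y z.
  by rewrite mul1r clamp_dist.
(* Continuity of [rho] is available only on [D]; [rho \o clamp c] is continuous everywhere and
   agrees with it on the box, so the superlevel set is cut out by a closed preimage. *)
have cK : compact K.
  have -> : K = box `&` (rho \o clamp c) @^-1` [set y | rho x0 <= y].
    apply/seteqP; split=> z [zc /= rz]; split=> //=.
      by rewrite clamp_id.
    by rewrite clamp_id in rz.
  apply: compact_closedI => //; apply: preimage_closed; last exact: closed_ge.
  move=> z _; apply: continuous_comp; first exact: cclamp.
  by apply: differentiable_continuous; apply/drho/BD; exact: cc.
(* [C1_on] gives continuity of the partial derivatives, so [W] is expanded along the coordinate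
   directions. *)
have cW : {within K, continuous W}.
  apply: (@subspace_eq_continuous _ K _
      (fun z => \sum_i f z ord0 i *: 'D_(evec i) rho z)).
    by move=> z; rewrite inE => -[zc _];
      apply/esym/derive_sum_evec; exact/drho/BD.
  apply: continuous_in_subspaceT => z; rewrite inE => -[zc _].
  apply: continuous_sum_at => i; apply: continuousM.
    apply: (@continuous_comp _ _ _ f (fun M : 'rV[R]_n => M ord0 i)).
      by apply: differentiable_continuous; exact/Cf.1/BD.
    exact: coord_continuous.
  have := crho i; rewrite continuous_open_subspace// => /(_ z); apply.
  by rewrite inE; exact: BD.
have K0 : K !=set0.
  by exists (x 0); split; [exact: xcW|rewrite /= xx0].
have [z0] := compact_EVT_min K0 cK cW.
rewrite inE => -[z0c z0rho] z0P.
set gamma := W z0 in z0P.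
have gamma0 : 0 < gamma by apply: Drho => //; exact: lt_le_trans z0rho.
have grow t : 0 <= t -> V 0 + gamma * t <= V t.
  move=> t0.
  have := @derive_ge0_le R (fun s => V s - gamma * s)
    (fun s => W (x s) - gamma) 0 t t0.
  rewrite mulr0 subr0 lerBrDr; apply.
    move=> s /andP[s0 _]; have := is_deriveZ gamma (is_derive_id s 1).
    rewrite [_ *: 1]mulr1 => dg; exact: is_deriveB (dV s s0) dg.
  move=> s /andP[s0 _]; rewrite subr_ge0 z0P// inE; split; first exact: xcW.
  by rewrite /= -V0 VV0.
have := rhoM 0 (lexx _); rewrite -subr_ge0 => MV0.
(* At this time the linear lower bound equals [rho zM + gamma], above the maximum of [rho] on the
   box. *)
pose t := (rho zM - V 0) / gamma + 1.
have t0 : 0 <= t by rewrite addr_ge0// divr_ge0// ltW.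
have := le_trans (grow t t0) (rhoM t t0).
rewrite /t mulrDr mulrC divfK ?gt_eqF// mulr1; lra.
Qed.

(** * Reduction of the four divergence conditions to Chetaev's criterion *)

Theorem theorem2p5 (R : realType) (n : nat) (D : set 'rV[R]_n)
  (f : 'rV[R]_n -> 'rV[R]_n) (rho : 'rV[R]_n -> R) (r : R) :
  is_domain D -> D 0 ->
  C1_on D f -> f 0 = 0 ->
  C1_on D rho -> rho 0 = 0 ->
  (forall e : R, 0 < e -> exists x0, [/\ D x0, enorm x0 < e & 0 < rho x0]) ->
  0 < r -> [set x | enorm x <= r] `<=` D ->
  let U := [set x | enorm x <= r /\ 0 < rho x] in
  let rhof := fun x => rho x *: f x in
  let rhoinvf := fun x => (rho x)^-1 *: f x in
  (  (forall x, U x -> div rhof x > rho x * div f x)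
  \/ (forall x, U x -> div rhoinvf x < 0 /\ div f x >= 0)
  \/ (exists beta : 'rV[R]_n -> R, forall x, U x ->
        div rhof x > beta x * rho x ^+ 2 * div rhoinvf x /\
        ((beta x > 1 /\ div f x >= 0) \/ beta x = 1))
  \/ (forall x, U x -> div rhof x > 0 /\ div rhoinvf x < 0)) ->
  lyap_unstable D f.
Proof.
move=> [oD _] _ Cf f0 Crho _ rhopos r0 BD U rhof rhoinvf conds.
have BU : [set x : 'rV[R]_n | `|x| <= r / n.+1%:R] `<=` [set x | enorm x <= r].
  by move=> x /= /enorm_le.
apply: (@chetaev_instability _ _ _ _ rho (r / n.+1%:R)) => //.
- by rewrite divr_gt0.
- by apply: subset_trans BD.
- by move=> e /rhopos[x0 [_ ? ?]]; exists x0.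
move=> x /BU/= xr rhox.
have Dx : D x by exact: BD.
have Ux : U x by [].
have df := Cf.1 x Dx; have drho := Crho.1 x Dx.
have rhoN0 : rho x != 0 by rewrite gt_eqF.
have E1 : div rhof x = 'D_(f x) rho x + rho x * div f x by exact: div_scale.
have E2 : rho x ^+ 2 * div rhoinvf x = - 'D_(f x) rho x + rho x * div f x.
  by rewrite /rhoinvf div_scaleV//; field.
have pos2 : 0 < rho x ^+ 2 by rewrite exprn_gt0.
(* With [a = 'D_(f x) rho x] and [b = rho x * div f x], the conditions read [a + b > b]; [b - a < 0]
   and [b >= 0]; [a + b > beta * (b - a)]; [a + b > 0] and [b - a < 0]. Each yields [a > 0]. *)
case: conds => [/(_ _ Ux)|[/(_ _ Ux)[]|[[beta /(_ _ Ux)[]]|/(_ _ Ux)[]]]].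
- by rewrite E1; lra.
- rewrite -(pmulr_rlt0 _ pos2) E2 => h /(mulr_ge0 (ltW rhox)); lra.
- rewrite -mulrA E1 E2 => h [[beta1 dfx]|beta1]; last by rewrite beta1 in h; lra.
  (* Rearranged, the third condition is [(1 + beta) * a > (beta - 1) * b], whose right side is
     nonnegative. *)
  have : 0 <= (beta x - 1) * (rho x * div f x).
    by rewrite mulr_ge0 ?subr_ge0 ?mulr_ge0// ltW.
  have : (0 < (1 + beta x) * 'D_(f x) rho x) -> 0 < 'D_(f x) rho x.
    by rewrite pmulr_rgt0//; lra.
  by move=> H h2; apply: H; lra.
- by rewrite -(pmulr_rlt0 (div rhoinvf x) pos2) E1 E2; lra.
Qed.
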